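(* Let $d$ be odd and let $\sigma_\triangle$ be a sign pattern of length $d+1$ with which the pair $(2,1)$ is compatible. Suppose that in $\sigma_\triangle$ there is a monomial $x^{2m}$ ($m\geq1$) and a monomial $x^{2n-1}$ ($n\ge 1$, $2n-1<d$) both with negative sign (either $2m<2n-1$ or $2n-1<2m$). For a polynomial realizing $(\sigma_\triangle,(2,1))$ denote its real roots by $-\beta<0<\alpha_1<\alpha_2$. Then for each of the five possibilities $$\beta<\alpha_1<\alpha_2,\quad \beta=\alpha_1<\alpha_2,\quad \alpha_1<\beta<\alpha_2,\quad \alpha_1<\alpha_2=\beta,\quad \alpha_1<\alpha_2<\beta,$$ there exists a polynomial realizing the couple $(\sigma_\triangle,(2,1))$ whose roots satisfy that possibility.
   Context: A sign pattern of length $d+1$ is a sequence of $d+1$ symbols $+$/$-$ beginning with $+$; a monic polynomial $x^d+\sum_{j<d}a_jx^j$ with all $a_j\neq0$ defines the sign pattern $(+,\operatorname{sign}(a_{d-1}),\ldots,\operatorname{sign}(a_0))$, and the sign of the monomial $x^j$ in the pattern is the entry corresponding to $a_j$. For a sign pattern with $c$ sign changes and $p$ sign preservations ($c+p=d$), a pair $(pos,neg)$ is compatible with it if $pos\le c$, $c-pos$ even, $neg\le p$, $p-neg$ even. A monic polynomial realizes the couple $(\sigma,(pos,neg))$ if it has all coefficients non-zero, defines $\sigma$, has exactly $pos$ positive and $neg$ negative real roots, all simple, and no other real roots. *)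

(* Defs.v *)
From mathcomp Require Import all_boot all_order all_algebra.
From mathcomp Require Import reals.
Set Implicit Arguments. Unset Strict Implicit. Unset Printing Implicit Defensive.
Import Order.TTheory GRing.Theory Num.Theory.
Local Open Scope ring_scope.

(* A sign pattern is a seq bool (true = '+', false = '-'), listed from the
   leading coefficient a_d down to a_0; it has length d+1 and starts with '+'. *)
Definition sign_pattern (d : nat) (sigma : seq bool) : Prop :=
  size sigma = d.+1 /\ head false sigma = true.

Definition sign_at (d : nat) (sigma : seq bool) (j : nat) : bool :=
  nth false sigma (d - j).

Definition sign_changes (d : nat) (sigma : seq bool) : nat :=
  count (fun i => nth false sigma i != nth false sigma i.+1) (iota 0 d).

Definition sign_preservations (d : nat) (sigma : seq bool) : nat :=
  (d - sign_changes d sigma)%N.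

Definition compatible (d : nat) (sigma : seq bool) (pos neg : nat) : Prop :=
  [/\ (pos <= sign_changes d sigma)%N, ~~ odd (sign_changes d sigma - pos),
      (neg <= sign_preservations d sigma)%N & ~~ odd (sign_preservations d sigma - neg)].

Definition defines_pattern (R : realType) (d : nat) (P : {poly R}) (sigma : seq bool) : Prop :=
  [/\ P \is monic, size P = d.+1,
      (forall j, (j < d)%N -> P`_j != 0) &
      (forall j, (j <= d)%N -> (0 < P`_j) = sign_at d sigma j)].

Definition realizes (R : realType) (d : nat) (P : {poly R}) (sigma : seq bool)
    (pos neg : nat) : Prop :=
  [/\ defines_pattern d P sigma,
      exists2 sp : seq R, [/\ uniq sp, size sp = pos & all (fun x => 0 < x) sp] &
        forall x : R, 0 < x -> (root P x <-> x \in sp),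
      exists2 sn : seq R, [/\ uniq sn, size sn = neg & all (fun x => x < 0) sn] &
        forall x : R, x < 0 -> (root P x <-> x \in sn),
      ~~ root P 0 &
      (forall x : R, root P x -> ~~ root P^`() x)].

Definition realizes_21_with_roots (R : realType) (d : nat) (P : {poly R})
    (sigma : seq bool) (a1 a2 b : R) : Prop :=
  [/\ realizes d P sigma 2 1, 0 < a1, a1 < a2, 0 < b &
      [/\ root P a1, root P a2 & root P (- b)]].

(* Main.v *)
Require Import Defs.
From mathcomp Require Import all_boot all_order all_algebra.
From mathcomp Require Import reals.
From mathcomp Require Import topology normedtype derive realfun.
From mathcomp Require Import polyrcf ring lra zify.
Set Implicit Arguments.
Unset Strict Implicit.
Unset Printing Implicit Defensive.
Import numFieldNormedType.Exports.
Import Order.TTheory GRing.Theory Num.Theory.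
Local Open Scope ring_scope.

(** Put K = 2n-1 and M = 2m. The realizing polynomials are
    P = x^d - B x^K - A x^M + a plus tiny terms with the prescribed signs, where
    A and B are tuned so that P(1) = dE + dO and P(-1) = dE - dO for tiny given
    dE, dO. With theta = x d/dx, the operator (theta - K)(theta - M) kills the
    two negative terms, so its value at P is positive on x > 0, and by Rolle P
    has at most two positive roots, both simple. For G(x) = - P(-x), either
    (theta - K) G (when a is small) or (theta - M) G (when a is large) is
    positive on x > 0, so P has exactly one negative root -b, which is simple.
    At dE = dO = 0 both 1 and -1 are roots of P; then a1 = 1 = b if a is large
    and a2 = 1 = b if a is small, because P(2) < 0, resp. P(1/2) < 0.
    The three strict orders come from small nonzero dO or dE. *)

(** * Euler shifts, Rolle's theorem and counting positive roots *)

(* theta - k with theta = x d/dx; its sign is that of (Q / x^k)' on x > 0. *)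
Definition euler_shift (R : realType) (k : nat) (Q : {poly R}) : {poly R} :=
  'X * Q^`() - k%:R *: Q.

Lemma euler_shiftE (R : realType) k (Q : {poly R}) x :
  (euler_shift k Q).[x] = x * Q^`().[x] - k%:R * Q.[x].
Proof. by rewrite /euler_shift !hornerE. Qed.

Lemma euler_shift_poly (R : realType) k N (w : nat -> R) :
  euler_shift k (\poly_(j < N.+1) w j) =
  \poly_(j < N.+1) ((j%:R - k%:R) * w j).
Proof.
apply/polyP => j.
rewrite coefB coefXM coefZ coef_deriv !coef_poly.
case: j => [|j] /=; first by ring.
by case: ifP => _; rewrite ?mulr0 ?mul0rn ?subr0 // -mulr_natl; ring.
Qed.

(** This is the mean value theorem for [Q / x^k], whose derivative on x > 0 is
    [euler_shift k Q / x^(k+1)]. *)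
Lemma mvt_euler_shift (R : realType) k (Q : {poly R}) (x y : R) :
  0 < x -> x < y ->
  exists2 c, x < c < y & Q.[y] / y ^+ k - Q.[x] / x ^+ k =
    (euler_shift k Q).[c] / c ^+ k.+1 * (y - x).
Proof.
move=> x0 xy.
have der (z : R) : 0 < z ->
    is_derive z 1 (fun u : R => Q.[u] / ('X^k).[u])
      ((euler_shift k Q).[z] / z ^+ k.+1).
  move=> z0; have zn : ('X^k).[z] != 0 by rewrite hornerXn expf_neq0 // gt_eqF.
  have dV := is_deriveV zn (is_derive_poly 'X^k z).
  have dM := is_deriveM (is_derive_poly Q z) dV.
  apply: is_derive_eq; rewrite euler_shiftE derivXn hornerMn !hornerXn.
  rewrite /GRing.scale /=.
  (* The derivative of ['X^k] carries the truncated exponent [k.-1], so k = 0 is treated apart. *)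
  case: k {zn dV dM} => [|k]; first by rewrite mulr0n; field; lra.
  rewrite -mulr_natl !exprS /=; field.
  by rewrite expf_neq0 ?andbT; lra.
have [||c] := @MVT R (fun u => Q.[u] / ('X^k).[u])
  (fun z => (euler_shift k Q).[z] / z ^+ k.+1) x y xy.
- by move=> z; rewrite in_itv /= => /andP[xz _]; apply: der; lra.
- apply: derivable_within_continuous => z; rewrite in_itv /= => /andP[xz _].
  by have [] := der z (lt_le_trans x0 xz).
by rewrite in_itv /= => cxy; rewrite !hornerXn => e; exists c.
Qed.

Lemma rolle_euler_shift (R : realType) k (Q : {poly R}) (x y : R) :
  0 < x -> x < y -> root Q x -> root Q y ->
  exists2 c, x < c < y & (euler_shift k Q).[c] = 0.
Proof.
move=> x0 xy /rootP Qx /rootP Qy.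
have [c /andP[xc cy]] := mvt_euler_shift k Q x0 xy.
rewrite Qx Qy !mul0r subrr => /esym/eqP; rewrite !mulf_eq0 subr_eq0.
rewrite (gt_eqF xy) orbF invr_eq0 expf_eq0 /= (gt_eqF (lt_trans x0 xc)) orbF.
by move=> /eqP e; exists c; rewrite ?xc.
Qed.

Lemma euler_shift_gt0_sign (R : realType) k (Q : {poly R}) (x y : R) :
  (forall z, 0 < z -> 0 < (euler_shift k Q).[z]) ->
  0 < x -> x < y -> 0 <= Q.[x] -> 0 < Q.[y].
Proof.
move=> Q1 x0 xy Qx.
have [c /andP[xc cy] e] := mvt_euler_shift k Q x0 xy.
have y0 := lt_trans x0 xy; have c0 := lt_trans x0 xc.
have : 0 < Q.[y] / y ^+ k.
  rewrite -(subrK (Q.[x] / x ^+ k) (Q.[y] / _)) e ltr_pwDl //.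
    by rewrite mulr_gt0 ?subr_gt0 ?divr_gt0 ?exprn_gt0 ?Q1.
  by rewrite divr_ge0 ?exprn_ge0 // ltW.
by rewrite pmulr_lgt0 // invr_gt0 exprn_gt0.
Qed.

(** [Q / x^k] is strictly increasing on x > 0, so b is its only zero and it passes there from
    negative to positive. The root is simple because the shift at b reduces to b Q'(b). *)
Lemma euler_shift_gt0_root (R : realType) k (Q : {poly R}) (b x : R) :
  (forall z, 0 < z -> 0 < (euler_shift k Q).[z]) ->
  0 < b -> root Q b -> 0 < x ->
  [/\ root Q x -> x = b, 0 < Q.[x] -> b < x, Q.[x] < 0 -> x < b &
      0 < Q^`().[b]].
Proof.
move=> Q1 b0 /rootP Qb x0.
have S := fun x y => @euler_shift_gt0_sign _ k Q x y Q1.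
split.
- move=> /rootP Qx; case: (ltgtP x b) => // h.
    by have := S _ _ x0 h; rewrite Qx Qb => /(_ (lexx _)); rewrite ltxx.
  by have := S _ _ b0 h; rewrite Qx Qb => /(_ (lexx _)); rewrite ltxx.
- move=> Qx; rewrite ltNge le_eqVlt; apply/negP => /orP[/eqP e|h].
    by move: Qx; rewrite e Qb ltxx.
  by have := S _ _ x0 h (ltW Qx); rewrite Qb ltxx.
- move=> Qx; rewrite ltNge le_eqVlt; apply/negP => /orP[/eqP e|h].
    by move: Qx; rewrite -e Qb ltxx.
  by have := S _ _ b0 h; rewrite Qb => /(_ (lexx _)); lra.
- by have := Q1 b b0; rewrite euler_shiftE Qb mulr0 subr0 pmulr_rgt0.
Qed.

(** Positivity of the double shift leaves [euler_shift k P] at most one positive zero. Rolle turns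
    three positive roots of P into two such zeros. A multiple root p or q is itself such a zero,
    next to the one that Rolle gives between p and q. *)
Lemma two_positive_roots (R : realType) k l (P : {poly R}) (p q : R) :
  (forall z, 0 < z -> 0 < (euler_shift l (euler_shift k P)).[z]) ->
  0 < p -> p < q -> root P p -> root P q ->
  [/\ forall x, 0 < x -> root P x -> x = p \/ x = q,
      P^`().[p] != 0 & P^`().[q] != 0].
Proof.
move=> P2 p0 pq Pp Pq; have q0 := lt_trans p0 pq.
have U x y : 0 < x -> x < y -> (euler_shift k P).[x] = 0 ->
    (euler_shift k P).[y] = 0 -> False.
  move=> x0 xy ex ey.
  have := euler_shift_gt0_sign P2 x0 xy.
  by rewrite ex ey lexx ltxx => /(_ isT).
have V x y z : 0 < x -> x < y -> y < z -> root P x -> root P y -> root P z ->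
    False.
  move=> x0 xy yz Px Py Pz.
  have [c /andP[xc cy] ec] := rolle_euler_shift k x0 xy Px Py.
  have [e /andP[ye ez] ee] :=
    rolle_euler_shift k (lt_trans x0 xy) yz Py Pz.
  exact: (U c e (lt_trans x0 xc) (lt_trans cy ye)).
have [c /andP[pc cq] ec] := rolle_euler_shift k p0 pq Pp Pq.
split.
- move=> x x0 Px; case: (ltgtP x p) => [h|h|]; last by left.
    by case: (V x p q).
  case: (ltgtP x q) => [h'|h'|]; last by right.
    by case: (V p x q).
  by case: (V p q x).
- apply/eqP => e; apply: (U p c p0 pc) => //.
  by rewrite euler_shiftE e (rootP Pp) !mulr0 subr0.
- apply/eqP => e; apply: (U c q (lt_trans p0 pc) cq) => //.
  by rewrite euler_shiftE e (rootP Pq) !mulr0 subr0.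
Qed.

(** * Four-term polynomials with a small perturbation *)

Lemma expr_le_add1 (R : realType) (x : R) j N :
  0 <= x -> (j <= N)%N -> x ^+ j <= 1 + x ^+ N.
Proof.
move=> x0 jN; have xN : 0 <= x ^+ N by exact: exprn_ge0.
have [x1|/ltW x1] := lerP x 1.
  by apply: (le_trans (exprn_ile1 _ x0 x1)); rewrite lerDl.
by apply: (le_trans (ler_weXn2l x1 jN)); rewrite lerDr.
Qed.

Lemma four_term_bound (R : realType) N K M (w : nat -> R) c x :
  (0 < K < N)%N -> (0 < M < N)%N -> K != M -> 0 <= c -> 0 <= x ->
  (forall j, (0 < j < N)%N -> j != K -> j != M -> `|w j| <= c) ->
  `|(\poly_(j < N.+1) w j).[x] -
    (w 0%N + w K * x ^+ K + w M * x ^+ M + w N * x ^+ N)|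
  <= N%:R * c * (1 + x ^+ N).
Proof.
move=> /andP[K0 KN] /andP[M0 MN] KM c0 x0 wc.
have N0 : (0 < N)%N by exact: leq_trans KN.
rewrite horner_poly big_ord_recr /=.
rewrite (bigD1 (Ordinal N0)) //= (bigD1 (Ordinal KN)) /=; last first.
  by rewrite -val_eqE /= -lt0n.
rewrite (bigD1 (Ordinal MN)) /=; last first.
  by rewrite -!val_eqE /= -lt0n M0 eq_sym.
set S := (\sum_(i < N | _) _); set e := (X in `|X|).
have -> : e = S by rewrite /e expr0; ring.
apply: le_trans (ler_norm_sum _ _ _) _.
(* The sum is enlarged to all N indices below N, which explains the factor N. *)
apply: (@le_trans _ _ (\sum_(i < N) c * (1 + x ^+ N))); last first.
  by rewrite sumr_const card_ord -[leLHS]mulr_natl mulrA.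
rewrite big_mkcond /=; apply: ler_sum => i _.
have x1 : 0 <= 1 + x ^+ N by rewrite addr_ge0 ?exprn_ge0.
case: ifP => [|_]; last exact: mulr_ge0.
rewrite -!val_eqE /= => /andP[/andP[i0 iK] iM].
rewrite normrM normrX (ger0_norm x0) ler_pM ?exprn_ge0 //.
  by apply: wc => //; rewrite lt0n i0 ltn_ord.
exact: expr_le_add1 (ltnW (ltn_ord i)).
Qed.

(** The scale h / N^3 allows for weights up to N^2 (two Euler shifts) and for N summands, so that
    the total error is at most h (1 + x^N). The 3h leaves room for tuning the values at 1 and -1. *)
Definition near_quadrinomial (R : realType) N K M (a h : R) (w : nat -> R) :=
  [/\ w 0%N = a, w N = 1, `|w K + 1| <= 3 * h, `|w M + a| <= 3 * h &
      forall j, (0 < j < N)%N -> j != K -> j != M -> `|w j| <= h / N%:R ^+ 3].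

Definition admissible_exponents N K M :=
  [&& odd N, odd K, ~~ odd M, (0 < M)%N, (M < N)%N & (K < N)%N].

Lemma admissible_exponentsP N K M : admissible_exponents N K M ->
  [/\ (0 < K < N)%N, (0 < M < N)%N & K != M].
Proof.
case/and5P=> oN oK oM M0 /andP[MN KN]; rewrite M0 MN KN odd_gt0 //.
by split=> //; apply: contraNneq oM => <-.
Qed.

Lemma admissible_exponents_natr (R : realType) N K M :
  admissible_exponents N K M ->
  [/\ 3 <= N%:R :> R, 1 <= K%:R :> R, 2 <= M%:R :> R,
      K%:R + 2 <= N%:R :> R & M%:R + 1 <= N%:R :> R].
Proof.
case/and5P=> oN oK oM M0 /andP[MN KN].
have K0 := odd_gt0 oK.
have H1 : (3 <= N)%N by lia.
have H2 : (2 <= M)%N by lia.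
(* K < N are both odd, so they differ by at least two. *)
have H3 : (K + 2 <= N)%N by lia.
have H4 : (M + 1 <= N)%N by lia.
by split; rewrite -?natrD ?natr1 ?ler1n ?ler_nat // -addn1.
Qed.

(** The weights u serve for plain evaluation, for the reflection signs and for the factors produced
    by Euler shifts. *)
Lemma near_quadrinomial_bound (R : realType) N K M (a h : R) w (u : nat -> R)
    x :
  admissible_exponents N K M -> near_quadrinomial N K M a h w ->
  0 <= h -> 0 <= x ->
  (forall j, (j <= N)%N -> `|u j| <= N%:R ^+ 2) ->
  `|(\poly_(j < N.+1) (u j * w j)).[x] -
    (u 0%N * a + u K * w K * x ^+ K + u M * w M * x ^+ M + u N * x ^+ N)|
  <= h * (1 + x ^+ N).
Proof.
move=> adm [w0 wN wK wM wj] h0 x0 uj.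
have [KN MN KM] := admissible_exponentsP adm.
have [n3 _ _ _ _] := admissible_exponents_natr R adm.
have n0 : N%:R != 0 :> R by rewrite gt_eqF //; lra.
have c0 : 0 <= N%:R ^+ 2 * (h / N%:R ^+ 3).
  by rewrite mulr_ge0 ?divr_ge0 ?exprn_ge0.
have := @four_term_bound R N K M (fun j => u j * w j) _ x KN MN KM c0 x0.
rewrite w0 wN mulr1.
have -> : N%:R * (N%:R ^+ 2 * (h / N%:R ^+ 3)) * (1 + x ^+ N) = h * (1 + x ^+ N).
  by field.
apply=> j /andP[j0 jN] jK jM.
by rewrite normrM ler_pM // ?uj ?wj ?j0 // ltnW.
Qed.

Lemma shift_weight_bound (R : realType) N j k : (j <= N)%N -> (k <= N)%N ->
  `|j%:R - k%:R : R| <= N%:R.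
Proof.
move=> jN kN; have := ler0n R j; have := ler0n R k.
have : (j%:R : R) <= N%:R by rewrite ler_nat.
have : (k%:R : R) <= N%:R by rewrite ler_nat.
by rewrite ler_norml => *; apply/andP; split; lra.
Qed.

(** Only K M a and (N - K)(N - M) x^N survive among the four main terms. They are at least a and
    x^N, which beat h (1 + x^N) because h < a and h < 1. *)
Lemma near_quadrinomial_shift_gt0 (R : realType) N K M (a h : R) w x :
  admissible_exponents N K M -> near_quadrinomial N K M a h w ->
  0 <= h < 1 -> h < a -> 0 < x ->
  0 < (euler_shift M (euler_shift K (\poly_(j < N.+1) w j))).[x].
Proof.
move=> adm nq /andP[h0 h1] ha x0.
have [/andP[K0 /ltnW KN] /andP[M0 /ltnW MN] _] := admissible_exponentsP adm.
have [n3 k1 m2 kn mn] := admissible_exponents_natr R adm.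
rewrite !euler_shift_poly.
pose u j : R := (j%:R - M%:R) * (j%:R - K%:R).
have uj j : (j <= N)%N -> `|u j| <= N%:R ^+ 2.
  move=> jN; rewrite normrM expr2.
  by apply: ler_pM => //; exact: shift_weight_bound.
under eq_poly do rewrite mulrA.
have := near_quadrinomial_bound adm nq h0 (ltW x0) uj.
rewrite /u !subrr mulr0 !mul0r !addr0 !sub0r mulrNN ler_norml => /andP[+ _].
have : 0 < x ^+ N by rewrite exprn_gt0.
move: (x ^+ N) => z z0 H.
have Ha : a <= M%:R * K%:R * a by rewrite ler_peMl //; [lra|nra].
have Hz : z <= (N%:R - M%:R) * (N%:R - K%:R) * z by rewrite ler_peMl ?ltW //; nra.
have Hh : h * z < z by rewrite gtr_pMl.
lra.
Qed.

(** * The reflected polynomial and its Euler shifts *)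

(* Coefficients of - P(-x), which is monic when P is monic of odd degree. *)
Definition reflect_coef (R : realType) (w : nat -> R) (j : nat) : R :=
  (-1) ^+ j.+1 * w j.

Lemma horner_reflect (R : realType) n (w : nat -> R) x :
  (\poly_(j < n) reflect_coef w j).[x] = - (\poly_(j < n) w j).[- x].
Proof.
rewrite !horner_poly -sumrN; apply: eq_bigr => j _.
by rewrite /reflect_coef (exprNn x) exprS; ring.
Qed.

Lemma deriv_reflect (R : realType) n (w : nat -> R) x : x != 0 ->
  (\poly_(j < n.+1) reflect_coef w j)^`().[x] = (\poly_(j < n.+1) w j)^`().[- x].
Proof.
move=> x0; apply: (mulfI x0).
(* After multiplication by x the derivative becomes [euler_shift 0], which acts coefficientwise. *)
have E (Q : {poly R}) y : y * Q^`().[y] = (euler_shift 0 Q).[y].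
  by rewrite euler_shiftE mul0r subr0.
rewrite E -[RHS]opprK -mulNr E !euler_shift_poly -horner_reflect.
by congr (_.[x]); apply: eq_poly => j _; rewrite /reflect_coef; ring.
Qed.

(* To be read with n, k, m the exponents N, K, M and y = x^M, z = x^N. *)
Lemma small_shift_ineq (R : realType) (n k m a h A y z : R) :
  3 <= n -> 1 <= k -> 2 <= m -> k + 2 <= n -> 0 < a -> 0 <= h ->
  a * n <= 1 -> 6 * n * h <= a -> `|A - a| <= 3 * h ->
  0 < z -> 0 <= y -> (y <= 1) \/ (1 <= z /\ y <= z) ->
  h * (1 + z) < k * a + (m - k) * A * y + (n - k) * z.
Proof.
rewrite ler_norml => n3 k1 m2 kn a0 h0 an nh /andP[Al Au] z0 y0 xy.
have nh3 : 3 * h <= n * h by rewrite ler_wpM2r.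
have an3 : a * 3 <= a * n by rewrite ler_pM2l.
have h1 : 18 * h <= a by lra.
have h2 : h * z <= 1 / 18 * z by rewrite ler_pM2r //; lra.
have A0 : 0 <= A by lra.
have mkA : - ((k - 1) * a) <= (m - k) * A.
  have [mk|km] := lerP k m.
    (* For k > m instead, m >= 2 leaves one spare a, which absorbs 3 (k - m) h <= a / 2. *)
    apply: (@le_trans _ _ 0); first by rewrite oppr_le0 mulr_ge0; lra.
    by rewrite mulr_ge0 // subr_ge0.
  suff : (k - m) * A <= (k - 1) * a by lra.
  have : (k - m) * A <= (k - m) * (a + 3 * h) by rewrite ler_wpM2l; lra.
  have : (k - m) * h <= n * h by rewrite ler_wpM2r; lra.
  have : (k - m) * a <= (k - 2) * a by rewrite ler_wpM2r; lra.
  lra.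
have mkAy : - ((k - 1) * a * y) <= (m - k) * A * y.
  by rewrite -mulNr ler_wpM2r.
have nkz : 2 * z <= (n - k) * z by rewrite ler_wpM2r; lra.
have ka0 : 0 <= (k - 1) * a by rewrite mulr_ge0; lra.
(* If y <= 1, then k a pays for the negative y term. Otherwise one of the two copies of z does,
   since (k - 1) a <= 1. *)
case: xy => [y1|[z1 yz]].
  have : (k - 1) * a * y <= (k - 1) * a * 1 by rewrite ler_wpM2l.
  lra.
have : (k - 1) * a * y <= (k - 1) * a * z by rewrite ler_wpM2l.
have : (k - 1) * a * z <= 1 * z.
  rewrite ler_wpM2r ?(ltW z0) //.
  have : (k - 1) * a <= n * a by rewrite ler_wpM2r; lra.
  lra.
lra.
Qed.

(* As above, except that y = x^K. *)
Lemma large_shift_ineq (R : realType) (n k m a h B y z : R) :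
  3 <= n -> 1 <= k -> 2 <= m -> k + 2 <= n -> m + 1 <= n -> n <= a -> 0 <= h ->
  6 * n * h <= 1 -> `|B - 1| <= 3 * h ->
  0 < z -> 0 <= y -> (y <= 1) \/ (1 <= z /\ y <= z) ->
  h * (1 + z) < m * a + (m - k) * B * y + (n - m) * z.
Proof.
rewrite ler_norml => n3 k1 m2 kn mn na h0 nh /andP[Bl Bu] z0 y0 xy.
have nh3 : 3 * h <= n * h by rewrite ler_wpM2r.
have h1 : 18 * h <= 1 by lra.
have h2 : h * z <= 1 / 18 * z by rewrite ler_pM2r //; lra.
have B0 : 0 <= B by lra.
have mkB : - (n - m - 1) <= (m - k) * B.
  have [mk|km] := lerP k m.
    (* For k > m instead, k + 2 <= n leaves a spare unit, which absorbs 3 (k - m) h <= 1/2. *)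
    by apply: (@le_trans _ _ 0); [lra|rewrite mulr_ge0 // subr_ge0].
  suff : (k - m) * B <= n - m - 1 by lra.
  have : (k - m) * B <= (k - m) * (1 + 3 * h) by rewrite ler_wpM2l; lra.
  have : (k - m) * h <= n * h by rewrite ler_wpM2r; lra.
  lra.
have mkBy : - ((n - m - 1) * y) <= (m - k) * B * y.
  by rewrite -mulNr ler_wpM2r.
have nmz : (n - m - 1) * z + z = (n - m) * z by ring.
have ma : 2 * a <= m * a by rewrite ler_wpM2r; lra.
have nm0 : 0 <= n - m - 1 by lra.
(* If y <= 1, then m a >= 2 n covers the loss n - m - 1. Otherwise (n - m) z covers it with one z to
   spare. *)
case: xy => [y1|[z1 yz]].
  have : (n - m - 1) * y <= (n - m - 1) * 1 by rewrite ler_wpM2l.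
  have : 0 <= (n - m - 1) * z by rewrite mulr_ge0 // ltW.
  lra.
have : (n - m - 1) * y <= (n - m - 1) * z by rewrite ler_wpM2l.
lra.
Qed.

Lemma expr_dichotomy (R : realType) (x : R) j N : 0 <= x -> (j <= N)%N ->
  x ^+ j <= 1 \/ (1 <= x ^+ N /\ x ^+ j <= x ^+ N).
Proof.
move=> x0 jN; have [x1|/ltW x1] := lerP x 1; [left|right].
  exact: exprn_ile1.
by rewrite exprn_ege1 // ler_weXn2l.
Qed.

Lemma reflect_shift_bound (R : realType) N K M (a h : R) w k x :
  admissible_exponents N K M -> near_quadrinomial N K M a h w ->
  (0 < k <= N)%N -> 0 <= h -> 0 <= x ->
  k%:R * a + (K%:R - k%:R) * w K * x ^+ K + (M%:R - k%:R) * (- w M) * x ^+ M +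
    (N%:R - k%:R) * x ^+ N - h * (1 + x ^+ N)
  <= (euler_shift k (\poly_(j < N.+1) reflect_coef w j)).[x].
Proof.
move=> adm nq /andP[k0 kN] h0 x0.
have [n3 _ _ _ _] := admissible_exponents_natr R adm.
rewrite euler_shift_poly.
pose u j : R := (j%:R - k%:R) * (-1) ^+ j.+1.
have uj j : (j <= N)%N -> `|u j| <= N%:R ^+ 2.
  move=> jN; rewrite normrM normrX normrN1 expr1n mulr1.
  apply: le_trans (shift_weight_bound R jN kN) _.
  by rewrite expr2 ler_peMl; lra.
have := near_quadrinomial_bound adm nq h0 x0 uj.
rewrite /u /reflect_coef; under eq_poly do rewrite -mulrA.
case/and5P: adm => oN oK oM _ _.
have s (i : nat) : (-1) ^+ i.+1 = (if odd i then 1 else -1) :> R.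
  by rewrite -signr_odd /=; case: (odd i); rewrite ?expr0 ?expr1.
rewrite ler_norml => /andP[+ _].
by rewrite !s oN oK (negbTE oM) /= sub0r !mulrN1 !mulr1; lra.
Qed.

(** After the shift by K or M one middle term remains, and it is negative only if M < K. The shift
    by K leaves x^M with coefficient near (M - K) a, harmless for small a. The shift by M leaves x^K
    with coefficient near M - K, controlled by the constant M a and by x^N for large a. *)
Lemma reflect_shift_gt0 (R : realType) N K M (a h : R) w :
  admissible_exponents N K M -> near_quadrinomial N K M a h w ->
  0 < a -> 0 <= h -> 6 * N%:R * h <= 1 -> 6 * N%:R * h <= a ->
  a * N%:R <= 1 \/ N%:R <= a ->
  exists k, forall x, 0 < x ->
    0 < (euler_shift k (\poly_(j < N.+1) reflect_coef w j)).[x].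
Proof.
move=> adm nq a0 h0 h1 ha aN.
have [/andP[K0 /ltnW KN] /andP[M0 /ltnW MN] _] := admissible_exponentsP adm.
have [n3 k1 m2 kn mn] := admissible_exponents_natr R adm.
have [_ _ wK wM _] := nq.
case: aN => aN; [exists K|exists M] => x x0.
- have KKN : (0 < K <= N)%N by rewrite K0.
  apply: lt_le_trans (reflect_shift_bound adm nq KKN h0 (ltW x0)).
  have wA : `|- w M - a| <= 3 * h by rewrite -opprD normrN.
  have := small_shift_ineq n3 k1 m2 kn a0 h0 aN ha wA (exprn_gt0 N x0)
    (exprn_ge0 M (ltW x0)) (expr_dichotomy (ltW x0) MN).
  by rewrite subrr; lra.
- have MMN : (0 < M <= N)%N by rewrite M0.
  apply: lt_le_trans (reflect_shift_bound adm nq MMN h0 (ltW x0)).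
  have wB : `|- w K - 1| <= 3 * h by rewrite -opprD normrN.
  have := large_shift_ineq n3 k1 m2 kn mn aN h0 h1 wB (exprn_gt0 N x0)
    (exprn_ge0 K (ltW x0)) (expr_dichotomy (ltW x0) KN).
  by rewrite subrr; lra.
Qed.

(** * Evaluation estimates and prescribed values at 1 and -1 *)

Lemma near_quadrinomial_horner (R : realType) N K M (a h : R) w x :
  admissible_exponents N K M -> near_quadrinomial N K M a h w ->
  0 <= h -> 0 <= x ->
  `|(\poly_(j < N.+1) w j).[x] - (a + w K * x ^+ K + w M * x ^+ M + x ^+ N)|
  <= h * (1 + x ^+ N).
Proof.
move=> adm nq h0 x0.
have [n3 _ _ _ _] := admissible_exponents_natr R adm.
have uj j : (j <= N)%N -> `|(fun=> 1) j : R| <= N%:R ^+ 2.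
  by move=> _; rewrite normr1 expr_ge1 //; lra.
have := near_quadrinomial_bound adm nq h0 x0 uj.
by under eq_poly do rewrite mul1r; rewrite !mul1r.
Qed.

Lemma near_quadrinomial_reflect_horner (R : realType) N K M (a h : R) w x :
  admissible_exponents N K M -> near_quadrinomial N K M a h w ->
  0 <= h -> 0 <= x ->
  `|(\poly_(j < N.+1) reflect_coef w j).[x] -
    (- a + w K * x ^+ K - w M * x ^+ M + x ^+ N)|
  <= h * (1 + x ^+ N).
Proof.
move=> adm nq h0 x0.
have [n3 _ _ _ _] := admissible_exponents_natr R adm.
have uj j : (j <= N)%N -> `|(fun i => (-1) ^+ i.+1) j : R| <= N%:R ^+ 2.
  by move=> _; rewrite normrX normrN1 expr1n expr_ge1 //; lra.
have := near_quadrinomial_bound adm nq h0 x0 uj.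
case/and5P: adm => oN oK oM _ _.
have s (i : nat) : (-1) ^+ i.+1 = (if odd i then 1 else -1) :> R.
  by rewrite -signr_odd /=; case: (odd i); rewrite ?expr0 ?expr1.
by rewrite /reflect_coef !s oN oK (negbTE oM) /= !mulN1r !mul1r mulNr.
Qed.

(** Since M is even and K odd, the coefficient of x^M moves only the even part of the value at 1,
    and that of x^K only the odd part. Hence dE and dO can be prescribed independently. *)
Lemma near_quadrinomial_exists (R : realType) N K M (s : nat -> bool)
    (a h dE dO : R) :
  admissible_exponents N K M -> 0 <= h -> `|dE| <= h -> `|dO| <= h ->
  exists w, [/\ near_quadrinomial N K M a h w,
    forall j, (0 < j < N)%N -> j != K -> j != M ->
      w j = (-1) ^+ (~~ s j) * (h / N%:R ^+ 3),
    (\poly_(j < N.+1) w j).[1] = dE + dO &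
    (\poly_(j < N.+1) w j).[-1] = dE - dO].
Proof.
move=> adm h0; rewrite !ler_norml => /andP[El Eu] /andP[Ol Ou].
have [KN MN KM] := admissible_exponentsP adm.
have [K0 KltN] := andP KN; have [M0 MltN] := andP MN.
have [n3 _ _ _ _] := admissible_exponents_natr R adm.
pose c := h / N%:R ^+ 3.
have c0 : 0 <= c by rewrite divr_ge0 // exprn_ge0.
pose w0 j := if j == 0 then a else if j == N then 1 else
  if (j == K) || (j == M) then 0 else (-1) ^+ (~~ s j) * c.
have w00 : w0 0 = a by [].
have w0N : w0 N = 1 by rewrite /w0 eqxx gtn_eqF // (leq_trans _ KltN).
have w0K : w0 K = 0 by rewrite /w0 eqxx gtn_eqF // ltn_eqF.
have w0M : w0 M = 0 by rewrite /w0 eqxx orbT gtn_eqF // ltn_eqF.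
have w0j j : (0 < j < N)%N -> j != K -> j != M -> w0 j = (-1) ^+ (~~ s j) * c.
  move=> /andP[j0 jN] jK jM; rewrite /w0 (negbTE jK) (negbTE jM).
  by rewrite gtn_eqF // ltn_eqF.
have nc j : (0 < j < N)%N -> j != K -> j != M -> `|w0 j| <= c.
  by move=> *; rewrite w0j // normrMsign ger0_norm.
have ncr j : (0 < j < N)%N -> j != K -> j != M -> `|reflect_coef w0 j| <= c.
  by move=> *; rewrite /reflect_coef normrM normrX normrN1 expr1n mul1r nc.
(* At 1 and -1 the small terms then contribute at most 2h. Adding |dE| or |dO| gives the 3h of
   [near_quadrinomial]. *)
have Nc : N%:R * c <= h.
  have -> : N%:R * c = h / N%:R ^+ 2 by rewrite /c; field; rewrite gt_eqF //; lra.
  rewrite ler_piMr // invf_le1 ?exprn_gt0 ?expr_ge1 //; lra.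
case/and5P: (adm) => oN oK oM _ _.
have := four_term_bound KN MN KM c0 ler01 ncr.
have := four_term_bound KN MN KM c0 ler01 nc.
rewrite horner_reflect /reflect_coef w00 w0N w0K w0M !expr1n !mul0r !mulr0.
rewrite -(signr_odd _ N.+1) /= oN expr0 mul0r expr1 !addr0 !mulr1.
set P0 := \poly_(j < N.+1) w0 j.
(* A and B solve the linear system given by the two prescribed values. *)
rewrite !ler_norml => /andP[Pl Pu] /andP[Gl Gu].
pose A := (P0.[1] + P0.[-1]) / 2 - dE.
pose B := (P0.[1] - P0.[-1]) / 2 - dO.
pose w j := if j == K then - B else if j == M then - A else w0 j.
have wK : w K = - B by rewrite /w eqxx.
have wM : w M = - A by rewrite /w eq_sym (negbTE KM) eqxx.
have wE j : j != K -> j != M -> w j = w0 j.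
  by rewrite /w => /negbTE-> /negbTE->.
have Pw : \poly_(j < N.+1) w j = P0 - B *: 'X^K - A *: 'X^M.
  apply/polyP => j; rewrite !coefB !coefZ !coefXn !coef_poly /w.
  case: (eqVneq j K) => [->|jK].
    by rewrite ltnS ltnW // w0K (negbTE KM) mulr0 mulr1 subr0 sub0r.
  case: (eqVneq j M) => [->|jM]; first by rewrite ltnS ltnW // w0M mulr0 mulr1 !sub0r oppr0 add0r.
  by rewrite !mulr0 !subr0.
exists w; split.
- split.
  + by rewrite wE // eq_sym gtn_eqF.
  + by rewrite wE // gtn_eqF.
  + by rewrite wK ler_norml /B; apply/andP; split; lra.
  + by rewrite wM ler_norml /A; apply/andP; split; lra.
  + by move=> j jN jK jM; rewrite wE // nc.
- by move=> j jN jK jM; rewrite wE // w0j.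
- by rewrite Pw !hornerE /= !expr1n /A /B; field.
- rewrite Pw !hornerE /= -(signr_odd _ K) -(signr_odd _ M) oK.
  by rewrite (negbTE oM) expr0 expr1 /A /B; field.
Qed.

(** * Locating roots and realizing the sign pattern *)

Lemma monic_root_gt (R : realType) (Q : {poly R}) x :
  Q \is monic -> Q.[x] < 0 -> exists2 y, x < y & root Q y.
Proof.
move=> /monicP lQ Qx.
have [|z Hz] := @poly_pinfty_gt_lc _ Q; first by rewrite lQ.
have := Hz (Num.max x z); rewrite le_max lexx orbT lQ => /(_ isT) Qz.
have [||y] := @poly_ivtoo _ Q x (Num.max x z); first by rewrite le_max lexx.
  by rewrite nmulr_rlt0 //; lra.
by rewrite in_itv /= => /andP[xy _] ry; exists y.
Qed.

Lemma root_between (R : realType) (Q : {poly R}) x y :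
  x < y -> Q.[x] * Q.[y] < 0 -> exists2 z, x < z < y & root Q z.
Proof.
move=> /ltW xy Qxy; have [z] := poly_ivtoo xy Qxy.
by rewrite in_itv /=; exists z.
Qed.

(** The parity telescopes along the pattern. It serves to show that the constant coefficient is
    positive. *)
Lemma sign_changes_odd (sigma : seq bool) d :
  odd (sign_changes d sigma) = (nth false sigma 0 != nth false sigma d).
Proof.
rewrite /sign_changes; elim: d => [|d IH]; first by rewrite eqxx.
rewrite -addn1 iotaD count_cat oddD IH /= add0n addn0 addn1 oddb.
by case: (nth _ _ 0); case: (nth _ _ d); case: (nth _ _ d.+1).
Qed.

(** What remains for each order of the roots is to exhibit two positive roots and to place b by the
    sign of P at a negative test point. The estimates on [wK] and [wM] are exported for the
    evaluations at 2 and 1/2. *)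
Lemma realizing_family (R : realType) d sigma K M (a h dE dO : R) :
  admissible_exponents d K M -> sign_at d sigma d -> sign_at d sigma 0 ->
  sign_at d sigma K = false -> sign_at d sigma M = false ->
  0 < a -> 0 < h -> 6 * d%:R * h <= 1 -> 6 * d%:R * h <= a ->
  a * d%:R <= 1 \/ d%:R <= a -> `|dE| <= h -> `|dO| <= h ->
  exists (P : {poly R}) (b wK wM : R),
  [/\ [/\ P \is monic, P.[0] = a, P.[1] = dE + dO & P.[-1] = dE - dO],
    [/\ `|wK + 1| <= 3 * h, `|wM + a| <= 3 * h,
      forall x, 0 <= x ->
        `|P.[x] - (a + wK * x ^+ K + wM * x ^+ M + x ^+ d)|
          <= h * (1 + x ^+ d) &
      forall x, 0 <= x ->
        `|- P.[- x] - (- a + wK * x ^+ K - wM * x ^+ M + x ^+ d)|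
          <= h * (1 + x ^+ d)],
    forall x, 0 < x ->
      [/\ P.[- x] = 0 -> x = b, P.[- x] < 0 -> b < x & 0 < P.[- x] -> x < b] &
    forall p q, 0 < p -> p < q -> root P p -> root P q ->
      realizes_21_with_roots d P sigma p q b].
Proof.
move=> adm sd s0 sK sM a0 h0 h1 ha ad dEh dOh.
have [w [nq wj P1 PN1]] :=
  near_quadrinomial_exists (sign_at d sigma) a adm (ltW h0) dEh dOh.
have [w0 wd wK wM wjc] := nq.
have [KN MN KM] := admissible_exponentsP adm.
have [n3 _ _ _ _] := admissible_exponents_natr R adm.
(* Thus 3h is at most 1/6 and at most a/6, which keeps [w K] and [w M] negative. *)
have nh3 : 3 * h <= d%:R * h by rewrite ler_wpM2r // ltW.
have d0 : d%:R != 0 :> R by rewrite gt_eqF //; lra.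
set P := \poly_(j < d.+1) w j in P1 PN1.
pose G := \poly_(j < d.+1) reflect_coef w j.
have wsign j : (j <= d)%N -> w j != 0 /\ (0 < w j) = sign_at d sigma j.
  rewrite leq_eqVlt => /predU1P[->|jd].
    by rewrite wd oner_neq0 ltr01 sd.
  case: (posnP j) => [->|j0]; first by rewrite w0 a0 gt_eqF // s0.
  case: (eqVneq j K) => [->|jK].
    have wn : w K < 0 by move: wK; rewrite ler_norml => /andP[l u]; lra.
    by rewrite sK lt_eqF // lt_gtF.
  case: (eqVneq j M) => [->|jM].
    have wn : w M < 0 by move: wM; rewrite ler_norml => /andP[l u]; lra.
    by rewrite sM lt_eqF // lt_gtF.
  have c0 : 0 < h / d%:R ^+ 3 by rewrite divr_gt0 // exprn_gt0 //; lra.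
  rewrite wj ?j0 // mulf_neq0 ?signr_eq0 ?(gt_eqF c0) //; split=> //.
  case: (sign_at d sigma j) => /=; first by rewrite mul1r.
  by rewrite expr1 mulN1r oppr_gt0 lt_gtF.
have Pj j : (j <= d)%N -> P`_j = w j by rewrite coef_poly ltnS => ->.
have sP : size P = d.+1 by rewrite size_poly_eq // wd oner_neq0.
have mP : P \is monic by rewrite monicE lead_coefE sP /= Pj // wd.
have od : odd d by case/and5P: adm.
have rd : reflect_coef w d = 1.
  by rewrite /reflect_coef -signr_odd /= od wd mulr1.
have mG : G \is monic.
  rewrite monicE lead_coefE size_poly_eq ?rd ?oner_neq0 //=.
  by rewrite coef_poly ltnSn rd.
have GP x : G.[x] = - P.[- x] by exact: horner_reflect.
have P0 : P.[0] = a by rewrite horner_coef0 Pj.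
have G0 : G.[0] < 0 by rewrite GP oppr0 P0 oppr_lt0.
have [b b0 rb] := monic_root_gt mG G0.
have [k Gk] := reflect_shift_gt0 adm nq a0 (ltW h0) h1 ha ad.
have Gb x := euler_shift_gt0_root Gk b0 rb (x := x).
have rootN x : root G x = root P (- x) by rewrite !rootE GP oppr_eq0.
exists P, b, (w K), (w M); split => //.
- split=> // x x0; first exact: near_quadrinomial_horner adm nq (ltW h0) x0.
  rewrite -GP; exact: near_quadrinomial_reflect_horner adm nq (ltW h0) x0.
- move=> x /Gb[]; rewrite rootE GP oppr_eq0 oppr_gt0 oppr_lt0 => X Y Z _.
  by split=> // /eqP.
move=> p q p0 pq rp rq.
have hlt1 : 0 <= h < 1 by rewrite ltW //=; lra.
have hlta : h < a by lra.
have [U dp dq] := two_positive_roots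
  (fun z => @near_quadrinomial_shift_gt0 _ _ _ _ _ _ _ z adm nq hlt1 hlta)
  p0 pq rp rq.
have q0 := lt_trans p0 pq.
have rN0 : ~~ root P 0 by rewrite rootE P0 gt_eqF.
have Uneg x : x < 0 -> root P x -> x = - b.
  move=> x0 rx; have [|+ _ _ _] := Gb (- x); first by rewrite oppr_gt0.
  by rewrite rootN opprK => /(_ rx) <-; rewrite opprK.
split=> //; last by rewrite -rootN.
split=> //.
- split=> // j jd; rewrite Pj ?(ltnW jd) //.
    by case: (wsign j (ltnW jd)).
  by case: (wsign j jd).
- exists [:: p; q]; first by split=> //=; rewrite ?inE ?lt_eqF ?p0 ?q0.
  move=> x x0; rewrite !inE; split=> [/(U _ x0)[]->|/orP[]/eqP->//].
    by rewrite eqxx.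
  by rewrite eqxx orbT.
- exists [:: - b]; first by split=> //=; rewrite oppr_lt0 b0.
  move=> x x0; rewrite !inE; split=> [/(Uneg _ x0)->//|/eqP->].
  by rewrite -rootN.
- move=> x rx; case: (ltgtP x 0) => [x0|x0|x0].
  (* Simplicity of -b follows from P'(-b) = G'(b) > 0. *)
  + rewrite (Uneg _ x0 rx) rootE -deriv_reflect ?gt_eqF //.
    by have [] := Gb b b0.
  + by case: (U _ x0 rx) => ->; rewrite rootE.
  + by move: rx; rewrite x0 (negbTE rN0).
Qed.

(** * The two regimes, a = 2^d and a = 2^-(d+1) *)

(** Here p and g stand for P(2) and -P(-2), with a = 2^N. In p, the term near -a 2^M <= -4 * 2^N
    outweighs the 2 * 2^N from the constant and leading terms. In g those two cancel, and a 2^M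
    outweighs 2^K. *)
Lemma large_value_at_2 (R : realType) N K M (h wK wM p g : R) :
  (K <= N)%N -> (1 < M)%N -> 0 <= h -> 18 * h <= 1 ->
  `|wK + 1| <= 3 * h -> `|wM + 2 ^+ N| <= 3 * h ->
  `|p - (2 ^+ N + wK * 2 ^+ K + wM * 2 ^+ M + 2 ^+ N)| <= h * (1 + 2 ^+ N) ->
  `|g - (- 2 ^+ N + wK * 2 ^+ K - wM * 2 ^+ M + 2 ^+ N)| <= h * (1 + 2 ^+ N) ->
  p < 0 < g.
Proof.
move=> KN M2 h0 h1.
have z1 : 1 <= 2 ^+ N :> R by rewrite exprn_ege1 //; lra.
have y0 : 0 <= 2 ^+ K :> R by rewrite exprn_ge0.
have yz : 2 ^+ K <= 2 ^+ N :> R by rewrite ler_weXn2l //; lra.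
have x4 : 4 <= 2 ^+ M :> R.
  by have -> : 4 = 2 ^+ 2 :> R; [ring|rewrite ler_weXn2l //; lra].
move: (2 ^+ N) (2 ^+ K) (2 ^+ M) z1 y0 yz x4 => z y x z1 y0 yz x4.
rewrite !ler_norml => /andP[Kl Ku] /andP[Ml Mu] /andP[_ pu] /andP[gl _].
have hz : h * z <= 1 / 18 * z by rewrite ler_wpM2r; lra.
have mx : wM * x <= (3 * h - z) * 4.
  have : (z - 3 * h) * 4 <= (- wM) * x by apply: ler_pM; lra.
  by lra.
have kl : - (1 + 3 * h) * z <= wK * y.
  apply: (@le_trans _ _ (- (1 + 3 * h) * y)); last by rewrite ler_wpM2r; lra.
  by rewrite !mulNr lerN2 ler_wpM2l; lra.
have ku : wK * y <= 0 by rewrite mulr_le0_ge0; lra.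
by apply/andP; split; lra.
Qed.

(** Since K + 2 <= N, the term near -2^-K is at most about -4 * 2^-N, while a + 2^-N is only 3/2 *
    2^-N. *)
Lemma small_value_at_half (R : realType) N K M (a h wK wM p : R) :
  (K + 2 <= N)%N -> a = 2^-1 ^+ N.+1 -> 0 <= h -> 18 * h <= a ->
  `|wK + 1| <= 3 * h -> `|wM + a| <= 3 * h ->
  `|p - (a + wK * 2^-1 ^+ K + wM * 2^-1 ^+ M + 2^-1 ^+ N)|
    <= h * (1 + 2^-1 ^+ N) ->
  p < 0.
Proof.
move=> KN -> h0.
have t0 : 0 <= 2^-1 :> R by lra.
have z0 : 0 < 2^-1 ^+ N :> R by rewrite exprn_gt0 //; lra.
have z1 : 2^-1 ^+ N <= 1 :> R by rewrite exprn_ile1 //; lra.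
have x0 : 0 <= 2^-1 ^+ M :> R by rewrite exprn_ge0.
have y4 : 4 * 2^-1 ^+ N <= 2^-1 ^+ K :> R.
  have : 2^-1 ^+ N <= 2^-1 ^+ (K + 2) :> R by rewrite ler_wiXn2l //; lra.
  by rewrite exprD expr2; lra.
rewrite exprS.
move: (2^-1 ^+ N) (2^-1 ^+ K) (2^-1 ^+ M) z0 z1 x0 y4 => z y x z0 z1 x0 y4 h1.
rewrite !ler_norml => /andP[Kl Ku] /andP[Ml Mu] /andP[_ pu].
have hz : h * z <= h * 1 by rewrite ler_wpM2l.
have mx : wM * x <= 0 by rewrite mulr_le0_ge0 //; lra.
have ky : wK * y <= (3 * h - 1) * (4 * z).
  have : (1 - 3 * h) * (4 * z) <= (- wK) * y by apply: ler_pM; lra.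
  by lra.
lra.
Qed.

(** This is the case dE = 0, dO = delta. The signs at 2 and -2 give b < 2 and, P being monic, a root
    beyond 2. *)
Lemma large_family (R : realType) d sigma K M (h delta : R) :
  admissible_exponents d K M -> sign_at d sigma d -> sign_at d sigma 0 ->
  sign_at d sigma K = false -> sign_at d sigma M = false ->
  h = (6 * d%:R)^-1 -> `|delta| <= h ->
  exists (P : {poly R}) (b : R),
  [/\ [/\ P \is monic, 0 < P.[0], P.[1] = delta & P.[-1] = - delta],
    P.[2] < 0, b < 2,
    forall x, 0 < x ->
      [/\ P.[- x] = 0 -> x = b, P.[- x] < 0 -> b < x & 0 < P.[- x] -> x < b] &
    forall p q, 0 < p -> p < q -> root P p -> root P q ->
      realizes_21_with_roots d P sigma p q b].
Proof.
move=> adm sd s0 sK sM hE dh.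
have [n3 _ _ _ _] := admissible_exponents_natr R adm.
have [/andP[_ /ltnW KN] _ _] := admissible_exponentsP adm.
have M2 : (1 < M)%N by case/and5P: adm; case: (M) => [|[]].
have d0 : d%:R != 0 :> R by rewrite gt_eqF //; lra.
have h0 : 0 < h by rewrite hE invr_gt0; lra.
have h6 : 6 * d%:R * h = 1 by rewrite hE; field.
have nh3 : 3 * h <= d%:R * h by rewrite ler_wpM2r // ltW.
have a1 : 1 <= 2 ^+ d :> R by rewrite exprn_ege1 //; lra.
have da : d%:R <= 2 ^+ d :> R.
  by rewrite -natrX ler_nat ltnW // ltn_expl.
have h1 : 6 * d%:R * h <= 1 by rewrite h6.
have ha : 6 * d%:R * h <= 2 ^+ d by rewrite h6.
have a0 : 0 < 2 ^+ d :> R by rewrite exprn_gt0.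
have z0 : `|0 : R| <= h by rewrite normr0 ltW.
have [P [b [wK [wM [[mP P0 P1 PN1] [HK HM HP HN] Hb Hr]]]]] :=
  realizing_family adm sd s0 sK sM a0 h0 h1 ha (or_intror da) z0 dh.
have /andP[P2 PN2] : P.[2] < 0 < - P.[- 2].
  apply: (large_value_at_2 KN M2 (ltW h0) _ HK HM (HP 2 _) (HN 2 _)) => //; lra.
exists P, b; split=> //.
- by split=> //; rewrite ?P0 ?P1 ?PN1 ?add0r ?sub0r //; lra.
- by have [//|_ + _] := Hb 2; apply; rewrite -oppr_gt0.
Qed.

(** This is the case dO = 0, dE = delta. The sign at 1/2 forces a positive root below 1/2. *)
Lemma small_family (R : realType) d sigma K M (h delta : R) :
  admissible_exponents d K M -> sign_at d sigma d -> sign_at d sigma 0 ->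
  sign_at d sigma K = false -> sign_at d sigma M = false ->
  h = 2^-1 ^+ d.+1 / (6 * d%:R) -> `|delta| <= h ->
  exists (P : {poly R}) (b : R),
  [/\ [/\ 0 < P.[0], P.[1] = delta & P.[-1] = delta],
    P.[2^-1] < 0,
    forall x, 0 < x ->
      [/\ P.[- x] = 0 -> x = b, P.[- x] < 0 -> b < x & 0 < P.[- x] -> x < b] &
    forall p q, 0 < p -> p < q -> root P p -> root P q ->
      realizes_21_with_roots d P sigma p q b].
Proof.
move=> adm sd s0 sK sM hE dh.
have [n3 _ _ _ _] := admissible_exponents_natr R adm.
have KN : (K + 2 <= d)%N by case/and5P: adm; lia.
have d0 : d%:R != 0 :> R by rewrite gt_eqF //; lra.
pose a : R := 2^-1 ^+ d.+1.
have a0 : 0 < a by rewrite exprn_gt0 //; lra.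
have a1 : a <= 1 by rewrite exprn_ile1 //; lra.
have h0 : 0 < h by rewrite hE divr_gt0 //; lra.
have h6 : 6 * d%:R * h = a by rewrite hE /a; field.
have nh3 : 3 * h <= d%:R * h by rewrite ler_wpM2r // ltW.
have ad : a * d%:R <= 1.
  rewrite /a exprVn mulrC ler_pdivrMr ?exprn_gt0 // mul1r.
  by rewrite -natrX ler_nat ltnW // (ltn_trans (ltnSn d)) // ltn_expl.
have h1 : 6 * d%:R * h <= 1 by rewrite h6.
have ha : 6 * d%:R * h <= a by rewrite h6.
have z0 : `|0 : R| <= h by rewrite normr0 ltW.
have [P [b [wK [wM [[mP P0 P1 PN1] [HK HM HP _] Hb Hr]]]]] :=
  realizing_family adm sd s0 sK sM a0 h0 h1 ha (or_introl ad) dh z0.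
exists P, b; split=> //.
- by split=> //; rewrite ?P0 ?P1 ?PN1 ?addr0 ?subr0.
- apply: (small_value_at_half KN (erefl a) (ltW h0) _ HK HM (HP 2^-1 _)).
    by rewrite -/a; lra.
  by lra.
Qed.

(** * The five orders of the roots *)

Theorem theorem4 (R : realType) (d : nat) (sigma : seq bool) (m n : nat) :
  odd d ->
  sign_pattern d sigma ->
  compatible d sigma 2 1 ->
  (1 <= m)%N -> (2 * m <= d)%N -> sign_at d sigma (2 * m) = false ->
  (1 <= n)%N -> (2 * n - 1 < d)%N -> sign_at d sigma (2 * n - 1) = false ->
  [/\ (exists P : {poly R}, exists a1 a2 b : R,
         realizes_21_with_roots d P sigma a1 a2 b /\ (b < a1 /\ a1 < a2)),
      (exists P : {poly R}, exists a1 a2 b : R,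
         realizes_21_with_roots d P sigma a1 a2 b /\ (b = a1 /\ a1 < a2)),
      (exists P : {poly R}, exists a1 a2 b : R,
         realizes_21_with_roots d P sigma a1 a2 b /\ (a1 < b /\ b < a2)),
      (exists P : {poly R}, exists a1 a2 b : R,
         realizes_21_with_roots d P sigma a1 a2 b /\ (a1 < a2 /\ a2 = b)) &
      (exists P : {poly R}, exists a1 a2 b : R,
         realizes_21_with_roots d P sigma a1 a2 b /\ (a1 < a2 /\ a2 < b))].
Proof.
move=> od [size_sigma head_sigma] [c2 c_even _ _] m1 md sM n1 nd sK.
(* As d is odd, 2m <= d is strict. *)
have adm : admissible_exponents d (2 * n - 1) (2 * m).
  by rewrite /admissible_exponents; lia.
have sd : sign_at d sigma d by rewrite /sign_at subnn nth0.
have s0 : sign_at d sigma 0.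
  move: c_even; rewrite oddB // addbF sign_changes_odd nth0 head_sigma negbK.
  by rewrite /sign_at subn0 => /eqP <-.
have [n3 _ _ _ _] := admissible_exponents_natr R adm.
have := large_family (R := R) adm sd s0 sK sM erefl.
set h := (6 * d%:R)^-1 => large.
have := small_family (R := R) adm sd s0 sK sM erefl.
set e := _ / _ => small.
have h0 : 0 < h by rewrite invr_gt0; lra.
have e0 : 0 < e by rewrite /e divr_gt0 ?exprn_gt0 //; lra.
have lt12 : 1 < 2 :> R by lra.
have lt01 : 0 < 1 :> R by lra.
have lt0h : 0 < 2^-1 :> R by lra.
have lth1 : 2^-1 < 1 :> R by lra.
split.
(* P(-1) < 0 gives b < 1, and P(1) > 0 > P(2) gives 1 < p < 2 < q. *)
- have [|P [b [[mP _ P1 PN1] P2 _ Hb Hr]]] := large h.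
    by rewrite ger0_norm // ltW.
  have [|p /andP[p1 p2] rp] := @root_between _ P 1 2 lt12.
    by rewrite P1 pmulr_rlt0.
  have [q q2 rq] := monic_root_gt mP P2.
  have [//|_ b1 _] := Hb 1; rewrite PN1 oppr_lt0 in b1.
  have pq := lt_trans p2 q2; have bp := lt_trans (b1 h0) p1.
  by exists P, p, q, b; split=> //; apply: Hr => //; exact: lt_trans p1.
(* Here b = p = 1 and q > 2. *)
- have [|P [b [[mP _ P1 PN1] P2 _ Hb Hr]]] := large 0.
    by rewrite normr0 ltW.
  have [q q2 rq] := monic_root_gt mP P2.
  have [//|b1 _ _] := Hb 1; rewrite PN1 oppr0 in b1.
  have rp : root P 1 by rewrite rootE P1.
  have pq := lt_trans lt12 q2.
  by exists P, 1, q, b; split; [exact: Hr|rewrite -(b1 erefl)].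
(* P(1) < 0 < P(-1) gives p < 1 < b < 2 < q. *)
- have [|P [b [[mP P0 P1 PN1] P2 b2 Hb Hr]]] := large (- h).
    by rewrite normrN ger0_norm // ltW.
  have [|p /andP[p0 p1] rp] := @root_between _ P 0 1 lt01.
    by rewrite P1 pmulr_rlt0 // oppr_lt0.
  have [q q2 rq] := monic_root_gt mP P2.
  have [//|_ _ b1] := Hb 1; rewrite PN1 opprK in b1.
  have pb := lt_trans p1 (b1 h0); have bq := lt_trans b2 q2.
  have pq := lt_trans pb bq.
  by exists P, p, q, b; split; [exact: Hr|].
(* Here p < 1/2 and q = b = 1. *)
- have [|P [b [[P0 P1 PN1] Ph Hb Hr]]] := small 0.
    by rewrite normr0 ltW.
  have [|p /andP[p0 p1] rp] := @root_between _ P 0 2^-1 lt0h.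
    by rewrite pmulr_rlt0.
  have [//|b1 _ _] := Hb 1; rewrite PN1 in b1.
  have rq : root P 1 by rewrite rootE P1.
  have pq := lt_trans p1 lth1.
  by exists P, p, 1, b; split; [exact: Hr|rewrite -(b1 erefl)].
(* P is positive at both 1 and -1, so p < 1/2 < q < 1 < b. *)
- have [|P [b [[P0 P1 PN1] Ph Hb Hr]]] := small e.
    by rewrite ger0_norm // ltW.
  have [|p /andP[p0 p1] rp] := @root_between _ P 0 2^-1 lt0h.
    by rewrite pmulr_rlt0.
  have [|q /andP[q0 q1] rq] := @root_between _ P 2^-1 1 lth1.
    by rewrite P1 nmulr_rlt0.
  have [//|_ _ b1] := Hb 1; rewrite PN1 in b1.
  have pq := lt_trans p1 q0; have qb := lt_trans q1 (b1 e0).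
  by exists P, p, q, b; split; [exact: Hr|].
Qed.
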